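(* For an integer $k\ge 0$, the $k$-th column of Catalan's triangle is the sequence $\{s_j\}_{j\ge 0}$ with $s_j = C(k+j,k)$. For every $k\ge 1$, there is no sequence of generalized action graphs for the $k$-th column of Catalan's triangle; for $k=0$, there is a sequence of generalized action graphs for the $0$-th column.
   Context: Catalan's triangle has entries $C(n,k)=\frac{n-k+1}{n+1}\binom{n+k}{k}$ for integers $n\ge k\ge 0$. Generalized action graphs. Let $\{s_n\}_{n\ge0}$ be a sequence of positive integers. A sequence of generalized action graphs for $\{s_n\}$ is a sequence $\{G_n\}_{n\ge 0}$ of directed graphs whose vertices are labeled by non-negative integers such that: (Axiom 1) $G_0$ is the graph with $s_0$ vertices labeled $0$ and no edges. For $n\ge1$, $G_n$ is constructed from $G_{n-1}$ by adding $s_n$ new vertices, each labeled $n$; each new vertex is attached by exactly one new edge, directed from some vertex of $G_{n-1}$ to the new vertex, and no other edges are added (so each connected component is a directed tree rooted at a vertex labeled $0$). (Axiom 2) For every $n$ and every vertex $v$ of $G_n$, the subtree of $G_n$ with root $v$ is isomorphic to $G_k$ for some $k\le n$. Here the subtree with root $v$ is the induced subgraph on $v$ and its descendants (the vertices $w$ for which there is a directed path from $v$ to $w$), and isomorphisms are isomorphisms of directed graphs respecting labels up to adding one constant to all labels. (Axiom 3) Every leaf of $G_n$ (vertex with no outgoing edge) has label $n$. *)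

(* Defs.v *)
From mathcomp Require Import all_boot all_order all_algebra.

Set Implicit Arguments.
Unset Strict Implicit.
Unset Printing Implicit Defensive.

(* The division is exact for k <= n: see catalan_triangle_exact and
   catalan_triangleE below. *)
Definition catalan_triangle (n k : nat) : nat :=
  ((n - k + 1) * 'C(n + k, k)) %/ n.+1.

Definition catalan_column (k j : nat) : nat := catalan_triangle (k + j) k.

Record ldigraph := LDigraph {
  vertex :> finType;
  arc : rel vertex;
  label : vertex -> nat
}.

Arguments arc {l} x y.
Arguments label {l} x.

(* The shift c is an integer rather than a natural number, so that this is a
   symmetric relation. *)
Definition shift_isomorphic (G H : ldigraph) : Prop :=
  exists (f : G -> H) (c : int),
    [/\ bijective f,
        forall x y : G, arc (f x) (f y) = arc x y &
        forall x : G, ((label (f x))%:Z = (label x)%:Z + c)%R].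

(* [connect] is reflexive, so the root v itself belongs to its subtree. *)
Definition subtree (G : ldigraph) (v : G) : ldigraph :=
  @LDigraph {w : G | connect arc v w}
    (fun x y => arc (val x) (val y)) (fun x => label (val x)).

(* [f] identifies G with the old part of G'; the vertices outside its image
   are the new ones. *)
Definition attaches_leaves (m n : nat) (G G' : ldigraph) : Prop :=
  exists f : G -> G',
    [/\ injective f,
        forall x : G, label (f x) = label x,
        forall x y : G, arc (f x) (f y) = arc x y,
        #|[predC codom f]| = m &
        forall w : G', w \notin codom f ->
          [/\ label w = n,
              exists v : G, forall u : G', arc u w = (u == f v) &
              forall u : G', ~~ arc w u]].

Definition action_axiom1 (s : nat -> nat) (G : nat -> ldigraph) : Prop :=
  [/\ #|G 0| = s 0,
      forall x : G 0, label x = 0,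
      forall x y : G 0, ~~ arc x y &
      forall n : nat, attaches_leaves (s n.+1) n.+1 (G n) (G n.+1)].

(* G k is the whole graph, even when it has several components. *)
Definition action_axiom2 (G : nat -> ldigraph) : Prop :=
  forall (n : nat) (v : G n),
    exists2 k, k <= n & shift_isomorphic (subtree v) (G k).

Definition action_axiom3 (G : nat -> ldigraph) : Prop :=
  forall (n : nat) (v : G n), (forall w : G n, ~~ arc v w) -> label v = n.

(* The notion is meant for sequences s of positive integers; the columns of
   Catalan's triangle are such sequences by catalan_column_gt0. *)
Definition generalized_action_graphs (s : nat -> nat) (G : nat -> ldigraph)
    : Prop :=
  [/\ action_axiom1 s G, action_axiom2 G & action_axiom3 G].

Lemma catalan_triangle_exact (n k : nat) :
  k <= n -> catalan_triangle n k * n.+1 = (n - k + 1) * 'C(n + k, k).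
Proof.
move=> le_kn; rewrite /catalan_triangle divnK //.
case: k le_kn => [|k] lt_kn; first by rewrite subn0 addn1 dvdn_mulr.
rewrite addn1 -subSn // mulnBl; apply: dvdn_sub; first by rewrite dvdn_mulr.
by rewrite mul_bin_left -addSnnS addnK dvdn_mulr.
Qed.

Lemma catalan_triangleE (n k : nat) : k <= n ->
  ((catalan_triangle n k)%:R =
     (n - k + 1)%:R / n.+1%:R * 'C(n + k, k)%:R :> rat)%R.
Proof.
move=> /catalan_triangle_exact /(congr1 (fun m : nat => m%:R%R : rat)).
rewrite !GRing.natrM GRing.mulrAC => <-.
by rewrite GRing.mulfK // Num.Theory.pnatr_eq0.
Qed.

Lemma catalan_column_gt0 (k j : nat) : 0 < catalan_column k j.
Proof.
have := catalan_triangle_exact (leq_addr j k); rewrite -/(catalan_column k j).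
case: (catalan_column k j) => // /esym/eqP.
by rewrite mul0n muln_eq0 addn1 /= -leqn0 leqNgt bin_gt0 leq_addl.
Qed.

(* Main.v *)
Require Import Defs.
From mathcomp Require Import all_boot all_order all_algebra.
From mathcomp Require Import zify.
(* Restores [arc], shadowed by [path.arc]. *)
Import Defs.

Set Implicit Arguments.
Unset Strict Implicit.
Unset Printing Implicit Defensive.

(** Axiom 2 for a vertex of [G 0] forces [s 0 = 1], since its subtree is a
    single vertex; this rules out [k >= 2], where [s 0] is a Catalan number > 1.
    If [s 0 = 1], each of the [s 1] leaves of [G 1] must get children in [G 2]
    by axiom 3, but too few for its subtree to be all of [G 2]; so its subtree
    is a copy of [G 1], it gets [s 1] children, and [s 1 ^ 2 <= s 2].  This
    rules out [k = 1], where the sequence starts with 1, 2, 3.  For [k = 0]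
    the graphs are directed paths. *)

Lemma shift_isomorphic_card (G H : ldigraph) :
  shift_isomorphic G H -> #|G| = #|H|.
Proof. by case=> f [c [bij_f _ _]]; apply: bij_eq_card bij_f. Qed.

Lemma subtree_card (G : ldigraph) (v : G) :
  #|subtree v| = #|[pred w | connect arc v w]|.
Proof. by rewrite /= card_sig. Qed.

Lemma subtree_leaf_card (G : ldigraph) (v : G) :
  (forall w : G, ~~ arc v w) -> #|subtree v| = 1.
Proof.
move=> leaf_v; rewrite subtree_card -(card1 v); apply: eq_card => w.
rewrite !inE; apply/connectP/eqP => [[[|u p] /= ] | ->]; last by exists [::].
- by move=> _ ->.
- by rewrite (negbTE (leaf_v u)).
Qed.

Lemma attaches_leaves_card (m n : nat) (G G' : ldigraph) :
  attaches_leaves m n G G' -> #|G'| = #|G| + m.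
Proof.
case=> f [inj_f _ _ <- _].
by rewrite -(cardC [in codom f]) card_codom.
Qed.

Lemma action_graphs_s0_le1 (s : nat -> nat) (G : nat -> ldigraph) :
  generalized_action_graphs s G -> s 0 <= 1.
Proof.
case=> -[card0 _ noarc0 _] ax2 _; rewrite -card0 leqNgt; apply/negP => gt1.
have /card_gt0P[v _] : 0 < #|G 0| by apply: ltnW.
have [k] := ax2 0 v; rewrite leqn0 => /eqP-> /shift_isomorphic_card.
by rewrite subtree_leaf_card // => eq1; rewrite -eq1 in gt1.
Qed.

(** Since [a] is a leaf of [G], every arc out of [f a] ends at a new vertex; new vertices have no
    outgoing arcs, so paths from [f a] have length at most 1. *)
Lemma subtree_new_leaves_card (G G' : ldigraph) (f : G -> G') (a : G) :
  (forall x y : G, arc (f x) (f y) = arc x y) ->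
  (forall w : G', w \notin codom f -> forall u : G', ~~ arc w u) ->
  (forall u : G, ~~ arc a u) ->
  #|subtree (f a)| = (#|[pred w | arc (f a) w]|).+1.
Proof.
move=> arc_f leaf_new leaf_a.
have new_w w : arc (f a) w -> w \notin codom f.
  move=> aw; apply/negP => /codomP[x xw].
  by move: aw; rewrite xw arc_f (negbTE (leaf_a x)).
rewrite subtree_card (cardD1 (f a)) !inE connect0; congr _.+1.
apply: eq_card => w; rewrite !inE; apply/andP/idP => [[neq]|aw].
- case/connectP=> -[/= _ eqw|u [|u' p] /=]; first by rewrite eqw eqxx in neq.
  + by rewrite andbT => au ->.
  + case/and3P=> /new_w /leaf_new /(_ u') /negbTE -> //.
- split; last exact: connect1.
  by apply: contraNneq (new_w w aw) => ->; apply: codom_f.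
Qed.

Lemma action_graphs_sqr_s1_le (s : nat -> nat) (G : nat -> ldigraph) :
  generalized_action_graphs s G -> s 0 = 1 -> 0 < s 1 -> s 1 ^ 2 <= s 2.
Proof.
case=> -[cardG0 _ _ attach] ax2 ax3 s0 s1_gt0.
have cardG1 := attaches_leaves_card (attach 0).
have cardG2 := attaches_leaves_card (attach 1).
case: (attach 0) => f [_ _ _ cardA newA].
case: (attach 1) => g [inj_g label_g arc_g cardB newB].
set A := [predC codom f] in cardA; set B := [predC codom g] in cardB.
have leafA a : a \in A -> forall u, ~~ arc a u by move=> /newA[].
have leafB w : w \notin codom g -> forall u, ~~ arc w u by move=> /newB[].
have arcB a w : a \in A -> arc (g a) w -> w \in B.
  move=> aA aw; apply/negP => /codomP[x xw].
  by move: aw; rewrite xw arc_g (negbTE (leafA a aA x)).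
have deg a : a \in A -> #|[pred w | arc (g a) w]| = s 1.
  move=> aA; set d := #|_|.
  (* In [G 2] the vertex [g a] still has label 1, so axiom 3 forbids it to be a leaf. *)
  have d_gt0 : 0 < d.
    rewrite lt0n; apply/negP => /eqP/card0_eq no_arc.
    have := ax3 2 (g a) (fun w => negbT (no_arc w)).
    by rewrite label_g; case/newA: aA => ->.
  have d_le : d <= s 2.
    by rewrite -cardB; apply/subset_leq_card/subsetP => w; apply: arcB.
  (* The subtree has [d + 1] vertices. [G 0] has 1, too few as [d > 0]; [G 2] has [1 + s 1 + s 2],
     too many as [d <= s 2] and [s 1 > 0]. Hence [k = 1] and [d + 1 = 1 + s 1]. *)
  have [k k_le /shift_isomorphic_card] := ax2 2 (g a).
  rewrite (subtree_new_leaves_card arc_g leafB (leafA a aA)) -/d.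
  by case: k k_le => [|[|[|//]]] _; lia.
(* Double counting of the arcs from [g a], [a] in [A], to [B]: there are [s 1] for each [a], and at
   most one into each [w] in [B], whose parent is unique. *)
rewrite -mulnn -{1}cardA -sum_nat_const -(eq_bigr _ deg).
rewrite -cardB -[leqRHS]sum1_card.
have -> : \sum_(a in A) #|[pred w | arc (g a) w]|
        = \sum_(a in A) \sum_(w in B) arc (g a) w.
  apply: eq_bigr => a aA; rewrite -sum1_card -big_mkcondr /=.
  apply: eq_bigl => w; rewrite !inE.
  by case aw: (arc _ _); rewrite ?andbF // andbT; apply/esym/(arcB a w).
rewrite exchange_big; apply: leq_sum => w /newB[_ [v parent_w] _] /=.
rewrite -big_mkcondr sum1_card; apply: leq_trans (_ : _ <= #|pred1 v|) _.
  apply/subset_leq_card/subsetP => a.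
  by rewrite unfold_in /= parent_w (inj_eq inj_g) => /andP[].
by rewrite card1.
Qed.

(** The entry times [k + 1] is the central binomial ['C(2k, k)], which is at least
    ['C(k + 2, 2) = (k + 2)(k + 1) / 2], so the entry is at least [(k + 2) / 2 >= 2]. *)
Lemma catalan_column_gt1 (k : nat) : 1 < k -> 1 < catalan_column k 0.
Proof.
move=> k_gt1; have := catalan_triangle_exact (leq_addr 0 k).
rewrite -/(catalan_column k 0) addn0 subnn mul1n => exact_k.
have : 'C(k.+2, k) <= 'C(k + k, k) by apply: leq_bin2l; lia.
rewrite -exact_k -(bin_sub (_ : k <= k.+2)); last by lia.
rewrite -addn2 addKn addn2; have := mul_bin_diag k.+2 1.
by rewrite bin1 /=; nia.
Qed.

Lemma catalan_column0 (j : nat) : catalan_column 0 j = 1.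
Proof.
by rewrite /catalan_column /catalan_triangle bin0 subn0 addn1 muln1 divnn.
Qed.

Definition path_graph (n : nat) : ldigraph :=
  @LDigraph 'I_n.+1 (fun i j => j == i.+1 :> nat) (fun i => i).

Lemma path_graph_attaches (n : nat) :
  attaches_leaves 1 n.+1 (path_graph n) (path_graph n.+1).
Proof.
pose f : path_graph n -> path_graph n.+1 := widen_ord (leqnSn n.+1).
have inj_f : injective f by move=> x y /(congr1 val) /= /val_inj.
exists f; split=> //.
  apply/eqP; rewrite -(eqn_add2l #|[in codom f]|) cardC card_codom // /=.
  by rewrite !card_ord addn1.
move=> w w_new; have w_max : val w = n.+1.
  apply/eqP; rewrite eqn_leq -ltnS ltn_ord /= leqNgt.
  apply: contra w_new => lt_w; apply/codomP; exists (Ordinal lt_w).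
  exact: val_inj.
split=> [//||u /=].
- exists ord_max => u; rewrite /= -val_eqE /= w_max eqSS eq_sym //.
- by rewrite w_max; have := ltn_ord u; lia.
Qed.

Lemma path_graph_connect (n : nat) (v w : path_graph n) :
  connect arc v w = (label v <= label w).
Proof.
apply/idP/idP.
  case/connectP=> p; elim: p v => [|u p IHp] v /=; first by move=> _ ->.
  by case/andP=> /eqP u_v path_p /(IHp _ path_p) /=; rewrite u_v; apply: ltnW.
(* Induction on the gap between the labels, stepping from [v] to its successor. *)
have [d] /= := ubnP (label w - label v).
elim: d v => //= d IHd v lt_d le_vw.
have [/ord_inj -> | neq_vw] := eqVneq (nat_of_ord v) (nat_of_ord w); first exact: connect0.
have lt_v : v.+1 < n.+1 by have := ltn_ord w; lia.
apply: (@connect_trans _ _ (Ordinal lt_v)); first exact: connect1.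
by apply: IHd => /=; lia.
Qed.

Lemma path_graph_subtree (n : nat) (v : path_graph n) :
  shift_isomorphic (subtree v) (path_graph (n - label v)).
Proof.
have le_v (x : subtree v) : label v <= label (val x).
  by rewrite -path_graph_connect (valP x).
have lt_f (x : subtree v) : label (val x) - label v < (n - label v).+1.
  by have := ltn_ord (val x); have := le_v x => /=; lia.
have lt_g (j : path_graph (n - label v)) : label v + label j < n.+1.
  by have := ltn_ord j; have := ltn_ord v => /=; lia.
have connect_g j : connect arc v (Ordinal (lt_g j) : path_graph n).
  by rewrite path_graph_connect leq_addr.
(* The descendants of [v] form the final segment of the path starting at [v]; translating by
   [- label v] makes it start at 0. *)
exists (fun x => Ordinal (lt_f x) : path_graph (n - label v)).
exists (- (label v)%:Z)%R.
split.
- exists (fun j => Sub (Ordinal (lt_g j) : path_graph n) (connect_g j)) => [x|j].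
  + by apply/val_inj/val_inj => /=; rewrite subnKC ?le_v.
  + by apply: val_inj; rewrite /= addKn.
- by move=> x y /=; rewrite -subSn ?le_v // eqn_sub2rE ?le_v // ltnW ?ltnS ?le_v.
- by move=> x /=; have := le_v x => /=; lia.
Qed.

Lemma path_graph_action (s : nat -> nat) :
  (forall n, s n = 1) -> generalized_action_graphs s path_graph.
Proof.
move=> s1; split.
- split=> [|x|x y|n]; first by rewrite s1 card_ord.
  + by rewrite [x]ord1.
  + by rewrite [x]ord1 [y]ord1.
  + by rewrite s1; apply: path_graph_attaches.
- by move=> n v; exists (n - label v);
    [apply: leq_subr | apply: path_graph_subtree].
- move=> n v leaf_v; apply/eqP; rewrite eqn_leq -ltnS ltn_ord /= leqNgt.
  apply/negP => lt_v; have := leaf_v (Ordinal (lt_v : (label v).+1 < n.+1)).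
  by rewrite /= eqxx.
Qed.

Theorem proposition3p4 :
  (forall k : nat, 1 <= k ->
     ~ exists G : nat -> ldigraph,
         generalized_action_graphs (catalan_column k) G) /\
  (exists G : nat -> ldigraph,
     generalized_action_graphs (catalan_column 0) G).
Proof.
split; last by exists path_graph; apply/path_graph_action/catalan_column0.
move=> [//|[|k]] _ [G ax].
(* Column 1 starts with 1, 2, 3, so the bound evaluates to the false [4 <= 3]. *)
- by have := action_graphs_sqr_s1_le ax erefl isT.
- by have := action_graphs_s0_le1 ax; rewrite leqNgt catalan_column_gt1.
Qed.
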